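(* Let $Q$ be a finite set, let $n\geq 1$ be an integer, and let $E=Q^n$ be equipped with the Hamming distance $d$. Let $m\geq 1$ and let $x_1,\dots,x_m\in E$ be points. Then the convex hull $\mathrm{Conv}(x_1,\dots,x_m)$ admits the following equivalent descriptions: (P1) $\mathrm{Conv}(x_1,\dots,x_m)$ is the intersection of the ``half-spaces'' $H_{i,\alpha}$ ($1\leq i\leq n$, $\alpha\in Q$) that contain $x_1,\dots,x_m$. (P2) $\mathrm{Conv}(x_1)=\{x_1\}$, and for $m\geq 2$: $$\mathrm{Conv}(x_1,\dots,x_m)=\bigcup_{x\in \mathrm{Conv}(x_1,\dots,x_{m-1})}[x,x_m].$$ (P3) $$\mathrm{Conv}(x_1,\dots,x_m)=\{\,x\in E \;|\; \forall i\in\{1,\dots,n\},\ \pi_i(x)\in\{\pi_i(x_1),\dots,\pi_i(x_m)\}\,\}.$$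
   Context: For a metric space $(E,d)$ and $x,y\in E$, the segment $[x,y]$ is the set of points $z\in E$ satisfying $d(x,y)=d(x,z)+d(z,y)$. A subset $K\subseteq E$ is convex if $[x,y]\subseteq K$ whenever $x,y\in K$. For a finite subset $S\subseteq E$, the convex hull $\mathrm{Conv}(S)$ is the smallest convex set containing $S$ (the intersection of all convex subsets of $E$ containing $S$), and $\mathrm{Conv}(x_1,\dots,x_m)$ means $\mathrm{Conv}(\{x_1,\dots,x_m\})$. In $E=Q^n$ (length-$n$ sequences over the alphabet $Q$), the Hamming distance $d(x,y)$ is the number of coordinates in which $x$ and $y$ differ, and $\pi_i:E\to Q$ denotes the projection on the $i$-th coordinate. A ``half-space'' in $E$ is a subset of the form $H_{i,\alpha}=\{x\in E \;|\; \pi_i(x)\neq\alpha\}$ with $1\leq i\leq n$ and $\alpha\in Q$. The intersection of the empty family of half-spaces is $E$. *)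

(* Defs.v *)
From mathcomp Require Import all_boot.

Set Implicit Arguments.
Unset Strict Implicit.
Unset Printing Implicit Defensive.

Section Convexity.

(* The carrier is finite, so {set T} comprises all of its subsets; the distance
   takes values in nat, as the Hamming distance does. *)
Variables (T : finType) (d : T -> T -> nat).

Definition segment (x y : T) : {set T} := [set z | d x y == d x z + d z y].

Definition convex (K : {set T}) : bool :=
  [forall x in K, forall y in K, segment x y \subset K].

Definition conv (S : {set T}) : {set T} :=
  \bigcap_(K : {set T} | convex K && (S \subset K)) K.

End Convexity.

Section Words.

Variables (Q : finType) (n : nat).

Definition hamming (x y : n.-tuple Q) : nat :=
  #|[set i : 'I_n | tnth x i != tnth y i]|.

Definition half_space (i : 'I_n) (a : Q) : {set n.-tuple Q} :=
  [set x | tnth x i != a].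

Definition hconv (S : {set n.-tuple Q}) : {set n.-tuple Q} := conv hamming S.

End Words.

(* Main.v *)
Require Import Defs.
From mathcomp Require Import all_boot.

(** Every description of the hull is compared with the box spanned by [S], the
    product of the projections of [S]. The Hamming distance is a sum over the
    coordinates of discrete distances, and the triangle inequality holds in each
    term; so [z] lies between [x] and [y] exactly when each coordinate of [z] is
    that of [x] or that of [y] ([in_segment_hamming]).

    Hence a box is convex ([convex_box]), and the hull of [S] lies inside the box
    of [S]. For the converse, adding a point [a] to a nonempty [S] enlarges the
    box exactly by the segments that end at [a] ([box_setU1]): given [z] in the
    larger box, keep its coordinates that occur in [S] and replace the others,
    which must be those of [a], by the coordinates of any fixed point of [S].
    By induction on the number of points, a convex set that contains [S] contains
    its box ([box_sub_convex]). So the hull of a nonempty set is its box, which is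
    the coordinatewise description; [box_setU1] becomes the recursive one; and
    the half-spaces that contain [S] exclude, coordinate by coordinate, exactly
    the letters that do not occur in [S] ([box_half_spaces]). *)

Section Boxes.

Context {Q : finType} {n : nat}.
Implicit Types (x y z a : n.-tuple Q) (S K : {set n.-tuple Q}).

Definition box S : {set n.-tuple Q} :=
  [set y | [forall i, tnth y i \in [set tnth s i | s in S]]].

Lemma in_box S y :
  reflect (forall i, exists2 s, s \in S & tnth y i = tnth s i) (y \in box S).
Proof.
rewrite inE; apply: (iffP forallP) => H i; first exact/imsetP/H.
exact/imsetP/H.
Qed.

Lemma hamming_sum x y : hamming x y = \sum_i (tnth x i != tnth y i).
Proof.
rewrite /hamming -sum1_card big_mkcond /=.
by apply: eq_bigr => i _; rewrite inE; case: (_ != _).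
Qed.

(** A sum of triangle inequalities is an equality only if each of them is one,
    and for the discrete distance on letters this leaves no third letter. *)
Lemma in_segment_hamming x y z :
  reflect (forall i, tnth z i = tnth x i \/ tnth z i = tnth y i)
          (z \in segment (@hamming Q n) x y).
Proof.
have triangle i : true -> (tnth x i != tnth y i) <=
    (tnth x i != tnth z i) + (tnth z i != tnth y i)
    ?= iff ((tnth z i == tnth x i) || (tnth z i == tnth y i)).
  move=> _; rewrite (eq_sym (tnth x i) (tnth z i)).
  have [->|zx] := eqVneq (tnth z i) (tnth x i); first exact/leqif_refl.
  have [<-|_] := eqVneq (tnth z i) (tnth y i); last by case: (_ == _).
  by rewrite eq_sym zx; exact/leqif_refl.
rewrite inE !hamming_sum -big_split /= (leqif_sum triangle).
apply: (iffP forallP) => H i.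
  by have /= /orP[/eqP|/eqP] := H i; [left | right].
by apply/orP; case: (H i) => ->; [left | right].
Qed.

Lemma sub_box S : S \subset box S.
Proof. by apply/subsetP => s sS; apply/in_box => i; exists s. Qed.

Lemma convex_box S : convex (@hamming Q n) (box S).
Proof.
apply/forall_inP => x /in_box xS; apply/forall_inP => y /in_box yS.
apply/subsetP => z /in_segment_hamming zxy; apply/in_box => i.
by case: (zxy i) => ->.
Qed.

Lemma box_set1 a : box [set a] = [set a].
Proof.
apply/eqP; rewrite eqEsubset sub_box andbT; apply/subsetP => y /in_box yS.
rewrite inE; apply/eqP/eq_from_tnth => i.
by have [s /set1P-> ->] := yS i.
Qed.

(** [S] must be nonempty: the box of the empty set is empty if [n] is positive,
    so no segment would reach [a] itself. *)
Lemma box_setU1 S a : S != set0 ->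
  box (a |: S) = \bigcup_(y in box S) segment (@hamming Q n) y a.
Proof.
case/set0Pn => s0 s0S; apply/setP => z; apply/idP/bigcupP.
  move=> /in_box zaS.
  pose y := [tuple if tnth z i \in [set tnth s i | s in S]
                   then tnth z i else tnth s0 i | i < n].
  exists y.
    apply/in_box => i; rewrite tnth_mktuple.
    case: ifP => [/imsetP[s sS ->]|_]; first by exists s.
    by exists s0.
  apply/in_segment_hamming => i; rewrite tnth_mktuple.
  case: ifP => [_|/negP zS]; first by left.
  right; have [s /setU1P[->//|sS] zs] := zaS i.
  by case: zS; apply/imsetP; exists s.
case=> y /in_box yS /in_segment_hamming zya; apply/in_box => i.
case: (zya i) => ->; last by exists a; rewrite ?setU11.
by have [s sS ->] := yS i; exists s; rewrite ?setU1r.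
Qed.

(** Removing a point [a] from [S] leaves a smaller box, which lies in [K] by
    induction; the segments from that box to [a] fill the box of [S] and stay
    in [K] because both of their ends do. *)
Lemma box_sub_convex S K :
  S != set0 -> convex (@hamming Q n) K -> S \subset K -> box S \subset K.
Proof.
move=> S0 convK; have [k] := ubnP #|S|; elim: k S S0 => // k IH S S0 Sk SK.
have /set0Pn[a aS] := S0; have aK := subsetP SK a aS.
have [Sa0|Sa0] := eqVneq (S :\ a) set0.
  by rewrite -(setD1K aS) Sa0 setU0 box_set1 sub1set.
rewrite -(setD1K aS) box_setU1 //; apply/bigcupsP => y yS.
have yK : y \in K.
  apply: (subsetP (IH _ Sa0 _ _)) yS.
    by move: Sk; rewrite (cardsD1 a S) aS.
  exact: subset_trans (subD1set S a) SK.
by move/forall_inP: convK => /(_ y yK) /forall_inP /(_ a aK).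
Qed.

Lemma hconv_box S : S != set0 -> hconv S = box S.
Proof.
move=> S0; apply/eqP; rewrite eqEsubset; apply/andP; split.
  by apply: bigcap_inf; rewrite convex_box sub_box.
by apply/bigcapsP => K /andP[convK SK]; apply: box_sub_convex.
Qed.

(** [S] lies in the half-space of [i] and [b] exactly when the letter [b] does not
    occur at [i] in [S]. To see that a letter of [y] does occur, test [y] against
    the half-space which that letter defines. *)
Lemma box_half_spaces S :
  box S = \bigcap_(p : 'I_n * Q | S \subset half_space p.1 p.2)
            half_space p.1 p.2.
Proof.
apply/setP => y; apply/in_box/bigcapP => [yS [i b] /= /subsetP Sib | yH i].
  by have [s sS ys] := yS i; have := Sib s sS; rewrite !inE ys.
apply/imsetP; apply: contraT => yiS.
suff /(yH (i, tnth y i)) : S \subset half_space i (tnth y i).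
  by rewrite inE eqxx.
apply/subsetP => s sS; rewrite inE; apply: contraNneq yiS => <-.
exact: imset_f.
Qed.

End Boxes.

Theorem theorem3 (Q : finType) (n : nat) (hn : 1 <= n) (m : nat) (hm : 1 <= m)
    (x : 'I_m -> n.-tuple Q) :
  [/\ (* P1 *)
      hconv [set x k | k : 'I_m]
      = \bigcap_(p : 'I_n * Q |
                  [set x k | k : 'I_m] \subset half_space p.1 p.2)
          half_space p.1 p.2,
      (* P2 *)
      hconv [set x (Ordinal hm)] = [set x (Ordinal hm)]
      /\ (2 <= m -> forall l : 'I_m, l.+1 = m ->
            hconv [set x k | k : 'I_m]
            = \bigcup_(y in hconv [set x k | k : 'I_m & k < l])
                segment (@hamming Q n) y (x l))
    & (* P3 *)
      hconv [set x k | k : 'I_m]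
      = [set y : n.-tuple Q |
          [forall i : 'I_n, tnth y i \in [set tnth (x k) i | k : 'I_m]]]].
Proof.
have hullx : hconv [set x k | k : 'I_m] = box [set x k | k : 'I_m].
  by apply/hconv_box/set0Pn; exists (x (Ordinal hm)); apply: imset_f.
split; first by rewrite hullx box_half_spaces.
  split=> [|m2 l lm].
    by rewrite hconv_box ?box_set1 // -card_gt0 cards1.
  have S0 : [set x k | k : 'I_m & k < l] != set0.
    apply/set0Pn; exists (x (Ordinal hm)); apply: imset_f.
    by rewrite inE -ltnS lm.
  rewrite hullx (hconv_box _ S0) -box_setU1 //; congr (box _).
  apply/setP => y; apply/imsetP/setU1P => [[k _ ->]|[->|/imsetP[k _ ->]]].
  - have [<-|kl] := eqVneq k l; first by left.
    right; apply: imset_f; rewrite inE ltn_neqAle.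
    by rewrite (inj_eq val_inj) kl -ltnS lm ltn_ord.
  - by exists l.
  - by exists k.
rewrite hullx; apply/setP => y; rewrite !inE; apply: eq_forallb => i.
by rewrite -imset_comp.
Qed.
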